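(* Let $s\leq t$ be positive integers. If $D$ is a bipartite tournament with $\delta^+(D)\geq t+\frac{(s+1)^4}{4s}-s$, then $D$ has a bipartition $(A,B)$ of $V(D)$ with $\delta^+(D[A])\geq s$ and $\delta^+(D[B])\geq t$.
   Context: All digraphs are finite and simple (no loops, no multiple arcs). A bipartite tournament is an orientation of a complete bipartite graph. For a digraph $D$, $\delta^+(D)$ is the minimum out-degree of $D$, and $D[A]$ is the subdigraph of $D$ induced by the vertex set $A$. A bipartition $(A,B)$ of $V(D)$ is a partition of $V(D)$ into two disjoint nonempty sets $A$ and $B$ (it need not be related to the two color classes of the underlying complete bipartite graph). *)

(* Defs.v *)
From mathcomp Require Import all_boot all_order all_algebra.

Set Implicit Arguments.
Unset Strict Implicit.
Unset Printing Implicit Defensive.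

(* A boolean relation rules out multiple arcs; 2-cycles are allowed. *)
Record digraph := Digraph {
  vertex :> finType;
  arc : rel vertex;
  arc_irrefl : irreflexive arc
}.

Definition outdeg (D : digraph) (x : D) : nat := #|[set y | arc x y]|.

(* Out-degrees are less than #|D|, so the default value #|D| of the minimum
   only matters when D has no vertex, where the minimum is set to 0. *)
Definition min_outdeg (D : digraph) : nat :=
  \big[minn/#|D|]_(x : D) outdeg x.

Section Induced.
Variables (D : digraph) (A : {set D}).

Definition induced_arc : rel {x : D | x \in A} :=
  fun x y => arc (val x) (val y).

Lemma induced_arc_irrefl : irreflexive induced_arc.
Proof. by move=> x; apply: arc_irrefl. Qed.

Definition induced : digraph := Digraph induced_arc_irrefl.
End Induced.

Definition complete_bipartite (V : finType) (X : {set V}) : rel V :=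
  fun x y => (x \in X) (+) (y \in X).

Definition orientation (D : digraph) (g : rel D) : Prop :=
  (forall x y : D, arc x y -> g x y) /\
  (forall x y : D, g x y -> arc x y (+) arc y x).

Definition bipartite_tournament (D : digraph) : Prop :=
  exists X : {set D},
    [/\ X != set0, ~: X != set0 & orientation (complete_bipartite X)].

Definition bipartition (V : finType) (A B : {set V}) : Prop :=
  [/\ A != set0, B != set0, [disjoint A & B] & A :|: B = [set: V]].

(* Main.v *)
Require Import Defs.
From mathcomp Require Import all_boot all_order all_algebra.
From mathcomp Require Import zify.

(* [path.arc] would otherwise shadow the arc relation of digraphs. *)
Import Defs.
Import GRing.Theory Num.Theory.

(** Let [A] be an inclusion-minimal nonempty set inducing minimum out-degree at
    least [s], and let [S] be the set of vertices of out-degree exactly [s] in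
    [D[A]].  Minimality forces every vertex of [A] to have an in-neighbour in
    [S].  Let [a], [b] count the vertices of [S], and [alpha], [beta] those of
    [A], in the two colour classes.  Counting arcs out of [S] gives
    [beta <= s a], [alpha <= s b] and
    [a b + alpha + beta <= (s + 1) (a + b)], whence
    [beta <= (s + 1)^4 / (4 s) - s], and symmetrically for [alpha].  A vertex
    outside [A] thus loses at most that many out-neighbours to [A], and the
    complement of [A] can serve as [B]. *)

Local Open Scope nat_scope.

Definition outdeg_in (D : digraph) (A : {set D}) (x : D) : nat :=
  #|[set y in A | arc x y]|.

(** Nonemptiness is included because the empty set, vacuously good, would otherwise be the only
    minimal set. *)
Definition has_outdeg (D : digraph) (k : nat) (A : {set D}) : bool :=
  (A != set0) && [forall x in A, k <= outdeg_in D A x].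

Definition tight (D : digraph) (k : nat) (A : {set D}) : {set D} :=
  [set x in A | outdeg_in D A x == k].

Lemma outdeg_inE (D : digraph) (A : {set D}) (x : D) :
  outdeg_in D A x = \sum_(y in A) arc x y.
Proof.
rewrite /outdeg_in -sum1_card big_mkcond [RHS]big_mkcond /=.
by apply: eq_bigr => y _; rewrite inE; case: (y \in A); case: (arc x y).
Qed.

Lemma outdeg_in_setC (D : digraph) (A : {set D}) (x : D) :
  outdeg x = outdeg_in D A x + outdeg_in D (~: A) x.
Proof.
rewrite /outdeg -(cardsID A); congr (_ + _); apply: eq_card => y;
by rewrite !inE andbC.
Qed.

Lemma min_outdeg_le (D : digraph) (x : D) : min_outdeg D <= outdeg x.
Proof.
rewrite /min_outdeg; have := mem_index_enum x.
elim: (index_enum _) => // y r IHr; rewrite inE big_cons geq_min.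
by case/orP => [/eqP<-|/IHr->]; rewrite ?leqnn ?orbT.
Qed.

Lemma min_outdeg_induced (D : digraph) (k : nat) (A : {set D}) :
  has_outdeg D k A -> k <= min_outdeg (induced A).
Proof.
case/andP => /set0Pn[x0 x0A] /forall_inP kA.
have outA (x : induced A) : k <= outdeg x.
  apply: (leq_trans (kA _ (valP x))).
  rewrite /outdeg -(card_imset _ val_inj); apply/subset_leq_card/subsetP => y.
  rewrite inE => /andP[yA xy]; apply/imsetP.
  by exists (exist _ y yA); rewrite ?inE.
rewrite /min_outdeg; elim/big_ind: _ => // [|m n km kn].
  (* The default value of the minimum is the order of [induced A], which is at least the out-degree
     of [x0]. *)
  exact: (leq_trans (outA (exist _ x0 x0A)) (max_card _)).
by rewrite leq_min km.
Qed.

(** As [A :\ v] is still nonempty, it can only fail through some [x] whose out-degree drops below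
    [k]. Deleting [v] costs [x] at most one arc, so [x] had exactly [k] and one of them goes to
    [v]. *)
Lemma minset_tight_in_neighbour (D : digraph) (k : nat) (A : {set D}) :
  0 < k -> minset (has_outdeg D k) A ->
  {in A, forall v, exists2 x, x \in tight D k A & arc x v}.
Proof.
move=> k_gt0 /minsetP[/andP[_ /forall_inP kA] minA] v vA.
have AvN : ~~ has_outdeg D k (A :\ v).
  apply/negP => /minA/(_ (subsetDl _ _)) AvE.
  by move: vA; rewrite -AvE !inE eqxx.
have Av0 : A :\ v != set0.
  have /card_gt0P[y] := leq_trans k_gt0 (kA _ vA); rewrite inE => /andP[yA vy].
  apply/set0Pn; exists y; rewrite !inE yA andbT.
  by apply: contraTneq vy => ->; rewrite arc_irrefl.
move: AvN; rewrite /has_outdeg Av0 => /forall_inPn[x].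
rewrite in_setD1 -ltnNge => /andP[_ xA] lt_k.
have outA : outdeg_in D A x = arc x v + outdeg_in D (A :\ v) x.
  by rewrite !outdeg_inE (big_setD1 v vA).
have := kA x xA; exists x; last by case: (arc x v) outA; lia.
by rewrite inE xA; case: (arc x v) outA; lia.
Qed.

(** If [a <= s + 1], then [q <= s * a] suffices. Otherwise, eliminating [p] and then [b] leaves a
    bound on [q] that is quadratic in [a]. *)
Lemma minimal_class_bound_arith (a b p q s : nat) :
  0 < s -> q <= s * a -> a <= p -> p <= s * b ->
  a * b + p + q <= s.+1 * (a + b) ->
  4 * s * q + 4 * s ^ 2 <= s.+1 ^ 4.
Proof.
case: s => // u _ qa ap pb abpq; have [a_le|a_gt] := leqP a u.+2.
  have q_le : 4 * u.+1 * q <= 4 * u.+1 * (u.+1 * u.+2).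
    by rewrite leq_mul2l (leq_trans qa) ?leq_mul2l ?a_le orbT.
  have -> : u.+2 ^ 4 =
      4 * u.+1 * (u.+1 * u.+2) + 4 * u.+1 ^ 2 + ((u * u.+2) ^ 2 + 4 * u.+1).
    by rewrite !expnS !expn0; lia.
  by lia.
have [c ac] : exists c, a = u.+2 + c by exists (a - u.+2); lia.
have q_le : q + b * c <= u.+1 * a.
  by move: abpq; rewrite {1}ac mulnDr !mulnDl (mulnC c) mulSn; lia.
have ac_le : a * c <= u.+1 * b * c by rewrite leq_mul2r (leq_trans ap pb) orbT.
(* Multiplying [q_le] by [s] produces [s * b * c], which is at least [a * c] by [ac_le]; this
   removes [b]. *)
have sq : u.+1 * q + a * a <= (u.+1 ^ 2 + u.+1 + 1) * a.
  have : u.+1 * (q + b * c) <= u.+1 * (u.+1 * a) by rewrite leq_mul2l q_le orbT.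
  by rewrite [X in _ + X * a <= _]ac expnS expn1; clear -ac_le; lia.
have amgm : 4 * (u.+1 * q) <= (u.+1 ^ 2 + u.+1 + 1) ^ 2.
  (* AM-GM applied to [s q <= a (s^2 + s + 1 - a)]. *)
  move: sq (nat_Cauchy (u.+1 ^ 2 + u.+1 + 1) (2 * a)).1.
  set m := _ + 1; by rewrite expnMn -!mulnn; clear; lia.
have -> : u.+2 ^ 4 = (u.+1 ^ 2 + u.+1 + 1) ^ 2 + 4 * u.+1 ^ 2
    + (2 * u ^ 3 + 5 * u ^ 2 + 6 * u + 3).
  by rewrite !expnS !expn0; lia.
by lia.
Qed.

Section BipartiteTournament.

Variables (D : digraph) (k : nat) (A : {set D}).
Hypotheses (k_gt0 : 0 < k) (minA : minset (has_outdeg D k) A).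

Let S := tight D k A.

Let SA x : x \in S -> x \in A. Proof. by rewrite inE => /andP[]. Qed.

Lemma arcs_from_tight (X : {set D}) :
  orientation (complete_bipartite X) ->
  \sum_(x in S :&: X) \sum_(y in A :\: X) arc x y = k * #|S :&: X|.
Proof.
case=> arcX _; rewrite mulnC -sum_nat_const; apply: eq_bigr => x.
rewrite inE => /andP[xS xX]; have: x \in S by [].
rewrite inE => /andP[_ /eqP<-]; rewrite outdeg_inE [RHS](big_setID X) /=.
rewrite [X in _ = X + _]big1 ?add0n // => y; rewrite inE => /andP[_ yX].
apply/eqP; rewrite eqb0; apply/negP => /arcX.
by rewrite /complete_bipartite xX yX.
Qed.

Lemma tight_in_class (X : {set D}) :
  orientation (complete_bipartite X) ->
  {in A :\: X, forall y, 0 < \sum_(x in S :&: X) arc x y}.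
Proof.
case=> arcX _ y; rewrite inE => /andP[yX yA].
have [x xS xy] := @minset_tight_in_neighbour D k A k_gt0 minA y yA.
have xX : x \in X.
  by have := arcX _ _ xy; rewrite /complete_bipartite (negPf yX) addbF.
have xSX : x \in S :&: X by rewrite inE xS.
by rewrite (bigD1 x xSX) /= xy.
Qed.

Lemma class_le_tight (X : {set D}) :
  orientation (complete_bipartite X) -> #|A :\: X| <= k * #|S :&: X|.
Proof.
move=> oX; rewrite -arcs_from_tight // exchange_big /= -sum1_card.
by apply: leq_sum => y; apply: tight_in_class.
Qed.

(** Of the [k * #|S :&: X|] arcs from [S :&: X] into [A :\: X], at least one enters each vertex
    outside [S]. *)
Lemma arcs_between_tight (X : {set D}) :
  orientation (complete_bipartite X) ->
  \sum_(x in S :&: X) \sum_(y in S :\: X) arc x y + #|A :\: X|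
    <= k * #|S :&: X| + #|S :\: X|.
Proof.
move=> oX; rewrite -arcs_from_tight // ![\sum_(x in S :&: X) _]exchange_big /=.
have sSA : S :\: X \subset A :\: X by apply/setSD/subsetP/SA.
rewrite (big_setID (S :\: X) (A := A :\: X)) /= (setIidPr sSA).
rewrite -addnA leq_add2l -[#|A :\: X|](cardsID (S :\: X)) (setIidPr sSA).
rewrite addnC leq_add2r -sum1_card; apply: leq_sum => y.
by rewrite inE => /andP[_]; apply: tight_in_class.
Qed.

Lemma orientation_setC (X : {set D}) :
  orientation (complete_bipartite X) -> orientation (complete_bipartite (~: X)).
Proof.
case=> arcX Xarc; rewrite /orientation /complete_bipartite.
by split=> [x y /arcX|x y]; rewrite !inE addbN addNb negbK //; apply: Xarc.
Qed.

Lemma tight_arcs_total (X : {set D}) :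
  orientation (complete_bipartite X) ->
  \sum_(x in S :&: X) \sum_(y in S :\: X) arc x y +
  \sum_(x in S :\: X) \sum_(y in S :&: X) arc x y = #|S :&: X| * #|S :\: X|.
Proof.
case=> _ Xarc; rewrite [X in _ + X]exchange_big -big_split -sum_nat_const /=.
apply: eq_bigr => x; rewrite inE => /andP[_ xX].
rewrite -big_split -sum1_card /=; apply: eq_bigr => y.
rewrite inE => /andP[yX _]; have := Xarc x y.
rewrite /complete_bipartite xX (negPf yX) => /(_ isT).
by case: (arc x y); case: (arc y x).
Qed.

Lemma minset_class_bound (X : {set D}) :
  orientation (complete_bipartite X) ->
  4 * k * #|A :\: X| + 4 * k ^ 2 <= k.+1 ^ 4.
Proof.
move=> oX; have oXC := orientation_setC X oX.
apply: (@minimal_class_bound_arith #|S :&: X| #|S :\: X| #|A :&: X|) => //.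
- exact: class_le_tight.
- by apply/subset_leq_card/setSI/subsetP/SA.
- by have := class_le_tight _ oXC; rewrite !setDE setCK.
(* Summing over both classes, the arcs within [S] add up to [a * b], and [a + b] moves into the
   factor [k.+1]. *)
have := arcs_between_tight _ oX; have := arcs_between_tight _ oXC.
by have := tight_arcs_total _ oX; rewrite !setDE setCK; lia.
Qed.

(** All out-neighbours of [x] lie in the class opposite to [x], so the bound on that part of [A]
    applies. *)
Lemma outdeg_in_minset_bound (X : {set D}) (x : D) :
  orientation (complete_bipartite X) ->
  4 * k * outdeg_in D A x + 4 * k ^ 2 <= k.+1 ^ 4.
Proof.
wlog xX : X / x \in X.
  move=> IH oX; case: (boolP (x \in X)) => [/IH|xX]; first exact.
  by apply: (IH (~: X)); rewrite ?inE //; apply: orientation_setC.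
move=> oX; apply: leq_trans (minset_class_bound X oX).
rewrite leq_add2r leq_mul2l; apply/orP; right.
apply/subset_leq_card/subsetP => y; rewrite !inE => /andP[-> /(proj1 oX)].
by rewrite /complete_bipartite xX addTb => ->.
Qed.

End BipartiteTournament.

Local Open Scope ring_scope.

Theorem theorem3 (s t : nat) (hs : (0 < s)%N) (hst : (s <= t)%N)
  (D : digraph) (hD : bipartite_tournament D)
  (hdeg : (min_outdeg D)%:R >=
          t%:R + (s%:R + 1) ^+ 4 / (4 * s%:R) - s%:R :> rat) :
  exists A B : {set D},
    [/\ bipartition A B,
        (min_outdeg (induced A) >= s)%N &
        (min_outdeg (induced B) >= t)%N].
Proof.
(* Multiplying by [4 * s] and moving the negative term across avoids division and truncated
   subtraction. *)
have {}hdeg : (4 * s * t + s.+1 ^ 4 <= 4 * s * min_outdeg D + 4 * s ^ 2)%N.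
  have s4 : 0 < 4 * s%:R :> rat by rewrite mulr_gt0 ?ltr0n.
  have := hdeg; rewrite -(ler_pM2l s4) mulrBr mulrDr [_ * (_ / _)]mulrC.
  rewrite divfK ?lt0r_neq0 // lerBlDr => h.
  rewrite -(ler_nat rat) !(natrD, natrM, natrX) -[s.+1%:R]natr1.
  by move: h; rewrite expr2 !mulrA.
have [X [/set0Pn[x0 _] _ oX]] := hD.
(* Since [4 * s ^ 2 < s.+1 ^ 4], the hypothesis even gives [t < min_outdeg D]. Hence the whole
   vertex set contains a minimal set. *)
have deg_gt : (s < min_outdeg D)%N.
  have lt_sq : (4 * s ^ 2 < s.+1 ^ 4)%N by rewrite !expnS !expn0; lia.
  have s4 : (0 < 4 * s)%N by rewrite muln_gt0.
  by apply: leq_ltn_trans hst _; rewrite -(ltn_pmul2l s4); lia.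
have hV : has_outdeg D s [set: D].
  apply/andP; split; first by apply/set0Pn; exists x0; rewrite inE.
  apply/forall_inP => x _; apply: (leq_trans (ltnW deg_gt)).
  apply: (leq_trans (min_outdeg_le D x)).
  by apply/subset_leq_card/subsetP => y; rewrite !inE.
have [A minA _] := minset_exists hV.
have hA : has_outdeg D s A by case/minsetP: minA.
have outB x : (t <= outdeg_in D (~: A) x)%N.
  have := outdeg_in_minset_bound D s A hs minA X x oX.
  have := min_outdeg_le D x; rewrite (outdeg_in_setC D A) => le_out bound.
  have s4 : (0 < 4 * s)%N by rewrite muln_gt0.
  move: le_out; rewrite -(leq_pmul2l s4) mulnDr => le_out.
  by rewrite -(leq_pmul2l s4); lia.
have B0 : ~: A != set0.
  have /card_gt0P[y] := leq_trans hs (leq_trans hst (outB x0)).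
  by rewrite inE => /andP[yB _]; apply/set0Pn; exists y.
exists A, (~: A); split; [split|exact: min_outdeg_induced|] => //.
- by case/andP: hA.
- by rewrite disjoints_subset setCK.
- by rewrite setUCr.
apply: min_outdeg_induced; rewrite /has_outdeg B0 /=.
by apply/forall_inP => x _; apply: outB.
Qed.
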